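(* Let $L$ be a residuated lattice and let $\mathcal{FI}(L)$ be the set of fuzzy ideals of $L$, ordered by $\mu_1\subset\mu_2$ iff $\mu_1(x)\le\mu_2(x)$ for all $x\in L$. Then $(\mathcal{FI}(L),\subset)$ is a complete Brouwerian lattice: it is a complete lattice, in which the infimum of a family $(\mu_i)_{i\in I}$ is the pointwise infimum $x\mapsto\inf_i\mu_i(x)$ and the supremum $\bigsqcup_i\mu_i$ is the fuzzy ideal generated by the pointwise supremum $x\mapsto\sup_i\mu_i(x)$, and for every $\mu\in\mathcal{FI}(L)$ and every family $(\mu_i)_{i\in I}$ in $\mathcal{FI}(L)$, $$\mu\sqcap\Big(\bigsqcup_{i\in I}\mu_i\Big)=\bigsqcup_{i\in I}(\mu\sqcap\mu_i).$$
   Context: A residuated lattice is an algebra $(L,\vee,\wedge,\odot,\rightarrow,0,1)$ such that $(L,\vee,\wedge,0,1)$ is a bounded lattice (with lattice order $\preceq$), $(L,\odot,1)$ is a commutative monoid, and $x\odot z\preceq y$ iff $x\preceq z\rightarrow y$ for all $x,y,z\in L$. Notation: $x^{\ast}=x\rightarrow 0$, $x\uplus y=x^{\ast}\rightarrow y$. A fuzzy ideal of $L$ is a map $\mu:L\to[0,1]$ such that (a) $x\preceq y$ implies $\mu(x)\ge\mu(y)$, and (b) $\mu(x\uplus y)\ge\min(\mu(x),\mu(y))$ for all $x,y\in L$. The fuzzy ideal generated by a map $\nu:L\to[0,1]$ is the smallest (pointwise) fuzzy ideal $\ge\nu$ pointwise. $\sqcap$ denotes the binary infimum (pointwise minimum)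 in $\mathcal{FI}(L)$. *)

(* Defs.v *)
From HB Require Import structures.
From mathcomp Require Import all_boot all_order all_algebra.
From mathcomp Require Import all_classical all_reals.

Set Implicit Arguments.
Unset Strict Implicit.
Unset Printing Implicit Defensive.

Import Order.TTheory GRing.Theory Num.Theory.

Local Open Scope classical_set_scope.
Local Open Scope ring_scope.

(* The least and greatest elements 0 and 1 are \bot and \top; the trivial
   algebra, in which they coincide, is allowed. *)
HB.mixin Record TBLattice_isResiduated (d : Order.disp_t) (L : Type)
    of Order.TBLattice d L := {
  rmul : L -> L -> L;
  rimp : L -> L -> L;
  rmulA : associative rmul;
  rmulC : commutative rmul;
  rmul1x : left_id (\top : L)%O rmul;
  residuation : forall x y z : L, (rmul x z <= y)%O = (x <= rimp z y)%O
}.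

#[short(type="residuatedLatticeType")]
HB.structure Definition ResiduatedLattice (d : Order.disp_t) :=
  { L of Order.TBLattice d L & TBLattice_isResiduated d L }.

Definition rneg (d : Order.disp_t) (L : residuatedLatticeType d) (x : L) : L :=
  rimp x \bot%O.

Definition uplus (d : Order.disp_t) (L : residuatedLatticeType d) (x y : L) : L :=
  rimp (rneg x) y.

Record fuzzyIdeal (R : realType) (d : Order.disp_t)
    (L : residuatedLatticeType d) := FuzzyIdeal {
  fi_fun :> L -> R;
  fi_unit : forall x : L, 0 <= fi_fun x <= 1;
  fi_anti : forall x y : L, (x <= y)%O -> fi_fun x >= fi_fun y;
  fi_uplus : forall x y : L,
    fi_fun (uplus x y) >= Num.min (fi_fun x) (fi_fun y)
}.

Fact fuzzy_ideal_display : Order.disp_t. Proof. exact: Order.Disp tt tt. Qed.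

Section FuzzyIdealOrder.
Variables (R : realType) (d : Order.disp_t) (L : residuatedLatticeType d).
Local Notation FI := (fuzzyIdeal R L).

Lemma fuzzyIdeal_ext (mu nu : FI) : mu =1 nu -> mu = nu.
Proof.
case: mu nu => [f f1 f2 f3] [g g1 g2 g3] /= /funext fg.
case: g / fg g1 g2 g3 => g1 g2 g3.
by congr FuzzyIdeal; exact: Prop_irrelevance.
Qed.

HB.instance Definition _ := gen_eqMixin FI.
HB.instance Definition _ := gen_choiceMixin FI.

Definition fi_le : rel FI := fun mu nu => `[< forall x : L, mu x <= nu x >].

Fact fi_le_refl : reflexive fi_le.
Proof. by move=> mu; apply/asboolP. Qed.

Fact fi_le_anti : antisymmetric fi_le.
Proof.
move=> mu nu /andP[/asboolP h1 /asboolP h2]; apply: fuzzyIdeal_ext => x.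
by apply/eqP; rewrite eq_le h1 h2.
Qed.

Fact fi_le_trans : transitive fi_le.
Proof.
move=> mu nu om /asboolP h1 /asboolP h2; apply/asboolP => x.
exact: le_trans (h1 x) (h2 x).
Qed.

HB.instance Definition _ :=
  Order.Le_isPOrder.Build fuzzy_ideal_display FI
    fi_le_refl fi_le_anti fi_le_trans.

Section Meet.
Variables mu nu : FI.
Let m (x : L) : R := Num.min (mu x) (nu x).

Fact fi_meet_unit x : 0 <= m x <= 1.
Proof.
have /andP[a0 a1] := fi_unit mu x; have /andP[b0 b1] := fi_unit nu x.
by rewrite /m le_min a0 b0 /= ge_min a1.
Qed.

Fact fi_meet_anti x y : (x <= y)%O -> m x >= m y.
Proof.
move=> xy; rewrite /m le_min !ge_min.
by rewrite (fi_anti mu xy) (fi_anti nu xy) orbT.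
Qed.

Fact fi_meet_uplus x y : m (uplus x y) >= Num.min (m x) (m y).
Proof.
rewrite /m minACA le_min; apply/andP; split.
  by apply: le_trans (fi_uplus mu x y); rewrite ge_min lexx.
by apply: le_trans (fi_uplus nu x y); rewrite ge_min lexx orbT.
Qed.

Definition fi_meet : FI := FuzzyIdeal fi_meet_unit fi_meet_anti fi_meet_uplus.
End Meet.

Fact fi_lexI (mu nu om : FI) :
  (mu <= fi_meet nu om)%O = (mu <= nu)%O && (mu <= om)%O.
Proof.
apply/asboolP/andP => [h|[/asboolP h1 /asboolP h2] x] /=.
  by split; apply/asboolP => x; have := h x; rewrite /= le_min => /andP[].
by rewrite le_min h1 h2.
Qed.

HB.instance Definition _ :=
  @Order.POrder_isMeetSemilattice.Build fuzzy_ideal_display FI fi_meet fi_lexI.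

End FuzzyIdealOrder.

(* Infimum and supremum computed in the unit interval rather than in R: for
   A included in [0, 1] the extra point is harmless, and it gives the empty
   family the infimum 1 and the supremum 0. *)
Definition unit_inf (R : realType) (A : set R) : R := inf (1 |` A).
Definition unit_sup (R : realType) (A : set R) : R := sup (0 |` A).

Definition pointwise_inf (R : realType) (d : Order.disp_t)
    (L : residuatedLatticeType d) (I : Type) (mu_ : I -> fuzzyIdeal R L) :
    L -> R :=
  fun x => unit_inf (range (fun i => mu_ i x)).

Definition pointwise_sup (R : realType) (d : Order.disp_t)
    (L : residuatedLatticeType d) (I : Type) (mu_ : I -> fuzzyIdeal R L) :
    L -> R :=
  fun x => unit_sup (range (fun i => mu_ i x)).

Definition generated_by (R : realType) (d : Order.disp_t)
    (L : residuatedLatticeType d) (nu : L -> R) (g : fuzzyIdeal R L) : Prop :=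
  (forall x, nu x <= g x) /\
  (forall mu : fuzzyIdeal R L, (forall x, nu x <= mu x) -> (g <= mu)%O).

Definition complete_lattice (d : Order.disp_t) (T : porderType d) : Prop :=
  forall A : set T, infimums A !=set0 /\ supremums A !=set0.

(* Main.v *)
Require Import Defs.
From mathcomp Require Import all_boot all_order all_algebra.
From mathcomp Require Import all_classical all_reals.

Local Open Scope classical_set_scope.
Local Open Scope ring_scope.

(* Infima are pointwise and suprema are infima of upper bounds, so only the
   distributive law has content.  It follows from the existence of relative
   pseudocomplements [mu ==> t] in FI(L).  Write x' for [rneg x]; the value of
   [mu ==> t] at x is the largest a such that min(a, mu w) <= t w for all
   w <= x''.  This map is closed under [uplus] because z <= (uplus x y)''
   implies z <= uplus (z'' /\ x'') (z'' /\ y''), a consequence of the inequality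
   (p \/ q) * (p \/ r) <= p \/ (q * r) applied to z', x', y'. *)

Set Implicit Arguments.
Unset Strict Implicit.
Unset Printing Implicit Defensive.

Import Order.TTheory GRing.Theory Num.Theory.

(** * Multiplication, negation and [uplus] in a residuated lattice *)

Section ResiduatedLatticeTheory.
Context {d : Order.disp_t} {L : residuatedLatticeType d}.
Implicit Types x y z w p q r : L.
Local Open Scope order_scope.

Lemma rmulx1 x : rmul x \top = x.
Proof. by rewrite rmulC rmul1x. Qed.

Lemma rmul_le2r z x y : x <= y -> rmul x z <= rmul y z.
Proof. by move=> xy; rewrite residuation (le_trans xy)// -residuation. Qed.

Lemma rmul_le2l z x y : x <= y -> rmul z x <= rmul z y.
Proof. by rewrite ![rmul z _]rmulC; exact: rmul_le2r. Qed.

Lemma rmul_lel x y : rmul x y <= x.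
Proof. by rewrite -[leRHS]rmulx1 rmul_le2l// lex1. Qed.

Lemma rmul_ler x y : rmul x y <= y.
Proof. by rewrite rmulC rmul_lel. Qed.

(** By residuation, multiplication by [z] is a left adjoint, hence preserves joins. *)
Lemma rmulUr z x y : rmul z (x `|` y) = rmul z x `|` rmul z y.
Proof.
apply/le_anti/andP; split; last first.
  by rewrite leUx !rmul_le2l// ?leUl ?leUr.
by rewrite rmulC residuation leUx -!residuation ![rmul _ z]rmulC leUl leUr.
Qed.

Lemma rmulUl z x y : rmul (x `|` y) z = rmul x z `|` rmul y z.
Proof. by rewrite rmulC rmulUr ![rmul z _]rmulC. Qed.

(** Expanding gives four products; all but [rmul q r] have a factor [p] and so lie below [p]. *)
Lemma rmulUU_le p q r : rmul (p `|` q) (p `|` r) <= p `|` rmul q r.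
Proof.
rewrite rmulUl !rmulUr !leUx leUr andbT -andbA.
by apply/and3P; split; apply: lexUl; rewrite ?rmul_lel ?rmul_ler.
Qed.

Lemma le_rneg x y : (x <= rneg y) = (rmul x y == \bot).
Proof. by rewrite -residuation lex0. Qed.

(** Both sides mean that [rmul x y] is [\bot]; thus [rneg] forms an antitone Galois connection with
    itself. *)
Lemma le_rnegC x y : (x <= rneg y) = (y <= rneg x).
Proof. by rewrite !le_rneg rmulC. Qed.

Lemma le_rnegK x : x <= rneg (rneg x).
Proof. by rewrite le_rnegC. Qed.

Lemma rneg_anti x y : x <= y -> rneg y <= rneg x.
Proof. by move=> xy; rewrite le_rnegC (le_trans xy)// le_rnegK. Qed.

Lemma rnegKn x : rneg (rneg (rneg x)) = rneg x.
Proof. by apply/le_anti; rewrite le_rnegK rneg_anti// le_rnegK. Qed.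

Lemma le_rneg_mul x y z : (x <= rneg (rmul y z)) = (rmul x y <= rneg z).
Proof. by rewrite !le_rneg rmulA. Qed.

Lemma rneg_mulKl x y : rneg (rmul (rneg (rneg x)) y) = rneg (rmul x y).
Proof.
apply: le_anti; rewrite !le_rneg_mul.
(* Both sides amount to [rmul w y <= rneg p], because p''' = p'. *)
have e w p : (rmul w (rneg (rneg p)) <= rneg y) = (rmul w p <= rneg y).
  rewrite le_rneg -rmulA [rmul _ y]rmulC rmulA -le_rneg rnegKn.
  by rewrite !le_rneg -!rmulA [rmul y p]rmulC.
by rewrite -e -le_rneg_mul lexx/= e -le_rneg_mul lexx.
Qed.

Lemma uplus0 x : uplus x \bot = rneg (rneg x).
Proof. by []. Qed.

Lemma uplus_rneg x y : uplus x (rneg y) = rneg (rmul (rneg x) y).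
Proof.
apply/le_anti; rewrite le_rneg_mul /uplus residuation lexx/=.
by rewrite -residuation -le_rneg_mul.
Qed.

Lemma uplus_le_rneg x y : uplus x y <= rneg (rmul (rneg x) (rneg y)).
Proof.
by rewrite le_rneg_mul (le_trans _ (le_rnegK y))// residuation.
Qed.

Lemma le_uplus_meet x y z : z <= rneg (rneg (uplus x y)) ->
  z <= uplus (rneg (rneg z) `&` rneg (rneg x)) (rneg (rneg z) `&` rneg (rneg y)).
Proof.
have rnegU p q : rneg p `&` rneg q = rneg (p `|` q).
  apply/le_anti/andP; split; last by rewrite lexI !rneg_anti// ?leUl ?leUr.
  by rewrite le_rnegC leUx !(le_rnegC _ (_ `&` _)) leIl leIr.
(* By De Morgan and [rneg_mulKl] the goal becomes (z' \/ x') * (z' \/ y') <= z'; after [rmulUU_le]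
   only x' * y' <= z' is left, which comes from [zxy]. *)
move=> zxy; rewrite !rnegU uplus_rneg rneg_mulKl le_rnegC.
apply: (le_trans (rmulUU_le _ _ _)); rewrite leUx lexx/= le_rnegC.
by apply: (le_trans zxy); rewrite le_rnegC rnegKn le_rnegC uplus_le_rneg.
Qed.

End ResiduatedLatticeTheory.

(** * Universal properties of bounds in the unit interval *)

Section UnitBounds.
Context {R : realType}.
Implicit Types (A : set R) (a : R).

(** The lower bound 0 and the adjoined point 1 make [inf] a true infimum rather than a default
    value; the point 1 accounts for [a <= 1]. *)
Lemma le_unit_inf A a : (forall b, A b -> 0 <= b) ->
  a <= unit_inf A <-> a <= 1 /\ forall b, A b -> a <= b.
Proof.
move=> A0; have lb : has_lbound (1 |` A).
  by exists 0 => b [->|/A0//]; exact: ler01.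
split=> [h|[a1 aA]].
  split=> [|b Ab]; apply: le_trans h _; apply: ge_inf => //; [by left|by right].
apply: lb_le_inf; first by exists 1; left.
by move=> b [->|/aA].
Qed.

Lemma unit_sup_le A a : (forall b, A b -> b <= 1) ->
  unit_sup A <= a <-> 0 <= a /\ forall b, A b -> b <= a.
Proof.
move=> A1; have ub : has_ubound (0 |` A).
  by exists 1 => b [->|/A1//]; exact: ler01.
split=> [h|[a0 aA]].
  split=> [|b Ab]; apply: le_trans h; apply: ub_le_sup => //; [by left|by right].
apply: ge_sup; first by exists 0; left.
by move=> b [->|/aA].
Qed.

End UnitBounds.

Section FuzzyIdealTheory.
Context {R : realType} {d : Order.disp_t} {L : residuatedLatticeType d}.
Local Notation FI := (fuzzyIdeal R L).
Implicit Types (mu nu t : FI) (A : set FI) (x y w : L).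

Lemma fi_leP mu nu : reflect (forall x, mu x <= nu x) (mu <= nu)%O.
Proof. exact: asboolP. Qed.

Lemma fi_ge0 mu x : 0 <= mu x.
Proof. by case/andP: (fi_unit mu x). Qed.

Lemma fi_le1 mu x : mu x <= 1.
Proof. by case/andP: (fi_unit mu x). Qed.

(** One inequality is antitonicity along x <= x''; the other holds since x'' is [uplus x \bot] and
    [mu] is largest at [\bot]. *)
Lemma fi_rnegK mu x : mu (rneg (rneg x)) = mu x.
Proof.
apply/le_anti; rewrite fi_anti ?le_rnegK//= -uplus0.
by apply: le_trans (fi_uplus mu _ _); rewrite le_min lexx fi_anti ?le0x.
Qed.

(** * Infima and suprema of fuzzy ideals *)

Section Inf.
Variable A : set FI.

Definition fi_inf_fun x : R := unit_inf [set mu x | mu in A].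

Lemma le_fi_inf_fun x a :
  a <= fi_inf_fun x <-> a <= 1 /\ forall mu, A mu -> a <= mu x.
Proof.
rewrite le_unit_inf => [|_ [mu _ <-]]; last exact: fi_ge0.
split=> -[a1 h]; split=> //; first by move=> mu Amu; apply: h; exists mu.
by move=> _ [mu Amu <-]; exact: h.
Qed.

Fact fi_inf_unit x : 0 <= fi_inf_fun x <= 1.
Proof.
apply/andP; split; last by have /le_fi_inf_fun[] := lexx (fi_inf_fun x).
by apply/le_fi_inf_fun; split=> // mu _; exact: fi_ge0.
Qed.

Fact fi_inf_anti x y : (x <= y)%O -> fi_inf_fun x >= fi_inf_fun y.
Proof.
move=> xy; have /le_fi_inf_fun[y1 yA] := lexx (fi_inf_fun y).
by apply/le_fi_inf_fun; split=> // mu /yA /le_trans; apply; exact: fi_anti.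
Qed.

Fact fi_inf_uplus x y :
  fi_inf_fun (uplus x y) >= Num.min (fi_inf_fun x) (fi_inf_fun y).
Proof.
have /le_fi_inf_fun[x1 xA] := lexx (fi_inf_fun x).
have /le_fi_inf_fun[_ yA] := lexx (fi_inf_fun y).
apply/le_fi_inf_fun; split=> [|mu Amu]; first by rewrite ge_min x1.
apply: le_trans (fi_uplus mu x y).
by rewrite le_min !ge_min xA// yA// orbT.
Qed.

Definition fi_inf : FI := FuzzyIdeal fi_inf_unit fi_inf_anti fi_inf_uplus.

Lemma fi_infP : infimums A fi_inf.
Proof.
split=> [mu Amu|nu nuA].
  by apply/fi_leP => x; have /le_fi_inf_fun[_] := lexx (fi_inf_fun x); exact.
apply/fi_leP => x; apply/le_fi_inf_fun; split=> [|mu /nuA/fi_leP//].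
exact: fi_le1.
Qed.

End Inf.

Lemma fi_supP A : supremums A (fi_inf (ubound A)).
Proof.
have [lb glb] := fi_infP (ubound A).
by split=> // mu Amu; apply: glb => nu; exact.
Qed.

Lemma fi_infE (I : Type) (mu_ : I -> FI) x :
  fi_inf (range mu_) x = pointwise_inf mu_ x.
Proof. by rewrite /= /fi_inf_fun image_comp. Qed.

(** The value 0 adjoined in [unit_sup] lies below every fuzzy ideal, so empty families are covered
    too. *)
Lemma pointwise_sup_le (I : Type) (mu_ : I -> FI) nu :
  (forall x, pointwise_sup mu_ x <= nu x) <-> ubound (range mu_) nu.
Proof.
have E x : pointwise_sup mu_ x <= nu x <-> forall i, mu_ i x <= nu x.
  rewrite unit_sup_le; last by move=> _ [i _ <-]; exact: fi_le1.
  split=> [[_ h] i|h]; first by apply: h; exists i.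
  by split=> [|_ [i _ <-]//]; exact: fi_ge0.
split=> [h _ [i _ <-]|h x]; first by apply/fi_leP => x; exact: (E x).1.
by apply/E => i; have /fi_leP : (mu_ i <= nu)%O by apply: h; exists i.
Qed.

Lemma supremums_generated (I : Type) (mu_ : I -> FI) s :
  supremums (range mu_) s -> generated_by (pointwise_sup mu_) s.
Proof.
by move=> [ub lub]; split=> [|nu /pointwise_sup_le/lub//]; exact/pointwise_sup_le.
Qed.

(** * Relative pseudocomplements and the distributive law *)

Section RelativePseudocomplement.
Variables mu t : FI.

(* The infimum of the Goedel implications mu w -> t w over w <= x''; those
   with mu w <= t w have value 1 and may be omitted. *)
Definition fi_imp_fun x : R :=
  unit_inf [set t w | w in [set w | (w <= rneg (rneg x))%O /\ t w < mu w]].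

(** Where [mu w <= t w] the condition on [w] is automatic; where [t w < mu w] it reduces to
    [a <= t w]. *)
Lemma le_fi_imp_fun x a : a <= fi_imp_fun x <->
  a <= 1 /\ forall w, (w <= rneg (rneg x))%O -> Num.min a (mu w) <= t w.
Proof.
rewrite le_unit_inf; last by move=> _ [w _ <-]; exact: fi_ge0.
split=> -[a1 h]; split=> //; last first.
  move=> _ [w [wx tw] <-].
  by have := h w wx; rewrite ge_min [mu w <= _]leNgt tw orbF.
move=> w wx; rewrite ge_min; case: leP => //= tw; case: leP => //= mt.
by move: tw; rewrite ltNge h//; exists w.
Qed.

Fact fi_imp_unit x : 0 <= fi_imp_fun x <= 1.
Proof.
apply/andP; split; last by have /le_fi_imp_fun[] := lexx (fi_imp_fun x).
by apply/le_fi_imp_fun; split=> // w _; rewrite ge_min fi_ge0.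
Qed.

Fact fi_imp_anti x y : (x <= y)%O -> fi_imp_fun x >= fi_imp_fun y.
Proof.
move=> xy; have /le_fi_imp_fun[y1 yA] := lexx (fi_imp_fun y).
apply/le_fi_imp_fun; split=> // w wx; apply: yA; apply: le_trans wx _.
by rewrite !rneg_anti.
Qed.

Fact fi_imp_uplus x y :
  fi_imp_fun (uplus x y) >= Num.min (fi_imp_fun x) (fi_imp_fun y).
Proof.
have /le_fi_imp_fun[x1 xA] := lexx (fi_imp_fun x).
have /le_fi_imp_fun[_ yA] := lexx (fi_imp_fun y).
apply/le_fi_imp_fun; split=> [|z /le_uplus_meet zxy]; first by rewrite ge_min x1.
(* It remains to bound [t] at z'' /\ x'' and z'' /\ y'', which are admissible [w] for [x] and [y];
   by [muz], [mu] is at least [mu z] there. *)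
apply: le_trans (fi_anti t zxy); apply: le_trans (fi_uplus t _ _).
have muz p : mu z <= mu (rneg (rneg z) `&` p)%O.
  by rewrite -[mu z]fi_rnegK fi_anti ?leIl.
rewrite le_min; apply/andP; split.
  by apply: le_trans (xA _ (leIr _ _)); rewrite le_min2 ?muz// ge_min lexx.
apply: le_trans (yA _ (leIr _ _)).
by rewrite le_min2 ?muz// ge_min lexx orbT.
Qed.

Definition fi_imp : FI := FuzzyIdeal fi_imp_unit fi_imp_anti fi_imp_uplus.

(** Left to right takes [w = x]. Conversely, w <= x'' gives nu x = nu x'' <= nu w, so the hypothesis
    at [w] suffices. *)
Lemma fi_le_imp nu : (nu <= fi_imp)%O = (mu `&` nu <= t)%O.
Proof.
apply/fi_leP/fi_leP => h x.
  by have /le_fi_imp_fun[_ /(_ x (le_rnegK x))] := h x; rewrite minC.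
apply/le_fi_imp_fun; split=> [|w wx]; first exact: fi_le1.
apply: le_trans (h w) => /=; rewrite minC le_min2//.
by rewrite -[nu x]fi_rnegK fi_anti.
Qed.

End RelativePseudocomplement.

(** By [fi_le_imp], meeting with [mu] is left adjoint to [fi_imp mu], hence preserves suprema. *)
Lemma fi_meet_sup mu (I : Type) (mu_ : I -> FI) s t :
  supremums (range mu_) s ->
  supremums (range (fun i => mu `&` mu_ i)%O) t -> (mu `&` s)%O = t.
Proof.
move=> [s_ub s_lub] [t_ub t_lub]; apply/le_anti/andP; split.
  rewrite -fi_le_imp; apply: s_lub => _ [i _ <-]; rewrite fi_le_imp.
  by apply: t_ub; exists i.
by apply: t_lub => _ [i _ <-]; rewrite leI2// s_ub//; exists i.
Qed.

End FuzzyIdealTheory.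

Theorem theorem1 (R : realType) (d : Order.disp_t)
    (L : residuatedLatticeType d) :
  [/\ complete_lattice (fuzzyIdeal R L),
      forall (I : Type) (mu_ : I -> fuzzyIdeal R L),
        exists2 m : fuzzyIdeal R L,
          infimums (range mu_) m & forall x : L, m x = pointwise_inf mu_ x,
      forall (I : Type) (mu_ : I -> fuzzyIdeal R L),
        exists2 s : fuzzyIdeal R L,
          supremums (range mu_) s & generated_by (pointwise_sup mu_) s
    & forall (mu : fuzzyIdeal R L) (I : Type) (mu_ : I -> fuzzyIdeal R L)
        (s t : fuzzyIdeal R L),
        supremums (range mu_) s ->
        supremums (range (fun i => Order.meet mu (mu_ i))) t ->
        Order.meet mu s = t].
Proof.
split=> [A|I mu_|I mu_|mu I mu_ s t].
- by split; [exists (fi_inf A); exact: fi_infP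
            |exists (fi_inf (ubound A)); exact: fi_supP].
- by exists (fi_inf (range mu_)); [exact: fi_infP|exact: fi_infE].
- exists (fi_inf (ubound (range mu_))); first exact: fi_supP.
  by apply: supremums_generated; exact: fi_supP.
- exact: fi_meet_sup.
Qed.
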